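(* Let $n\geq 8$ be an integer with $n\not\equiv 1\pmod 3$, let $E=E(W_n)$ be the eccentricity matrix of the wheel graph $W_n$, and let $\mathbf{w}=\frac{1}{6}(7-n,1,\dots,1)'\in\mathbb{R}^n$. Let $\widetilde{L}$ be the $n\times n$ matrix $$\widetilde{L}=\frac{n-1}{3}I_n-\frac13\begin{bmatrix}0&\mathbf{e}'\\ \mathbf{e}&\mathbf{0}\end{bmatrix}+\begin{bmatrix}0&\mathbf{0}'\\ \mathbf{0}&M\end{bmatrix},$$ where $M=\frac13\operatorname{Circ}(\bar{\mathbf{x}}')$ if $n\equiv 2\pmod 3$ and $M=\frac13\operatorname{Circ}(\bar{\mathbf{y}}')$ if $n\equiv 0\pmod 3$, with $\bar{\mathbf{x}},\bar{\mathbf{y}}\in\mathbb{R}^{n-1}$ given by $$\bar{\mathbf{x}}=(2-n,\underbrace{1,-2,1},\dots,\underbrace{1,-2,1})',\qquad \bar{\mathbf{y}}=(-n,\underbrace{2,-1,-1},\dots,\underbrace{2,-1,-1},2)'.$$ Then $$E^{-1}=-\frac12\widetilde{L}+\frac{6}{n-1}\mathbf{w}\mathbf{w}'.$$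
   Context: The prime denotes transpose, $I_n$ is the identity matrix, and $\mathbf{e}$ denotes the all-ones column vector (here in $\mathbb{R}^{n-1}$). In the block matrices the blocks have sizes $1$ and $n-1$. For a vector $\mathbf{c}=(c_1,\dots,c_m)'$, $\operatorname{Circ}(\mathbf{c}')$ is the $m\times m$ circulant matrix with first row $(c_1,c_2,\dots,c_m)$ and each subsequent row the cyclic right shift by one of the previous row (so the second row is $(c_m,c_1,\dots,c_{m-1})$). For a simple connected graph $G$ with vertices $v_1,\dots,v_n$, let $d(v_i,v_j)$ be the length of a shortest path between $v_i$ and $v_j$, and let $e(v_i)=\max\{d(v_i,v_j):1\le j\le n\}$. The eccentricity matrix $E(G)$ is the $n\times n$ real matrix with $(E(G))_{ij}=d(v_i,v_j)$ if $d(v_i,v_j)=\min\{e(v_i),e(v_j)\}$, and $(E(G))_{ij}=0$ otherwise. The wheel graph $W_n$ is the graph on $n$ vertices consisting of a cycle of length $n-1$ together with one further vertex (the hub) adjacent to every vertex of the cycle. The vertices are labelled so that $v_1$ is the hub and $v_2,\dots,v_n$ are the cycle vertices in cyclic order. *)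

(* Defs.v *)
From mathcomp Require Import all_boot all_order all_algebra.

Set Implicit Arguments.
Unset Strict Implicit.
Unset Printing Implicit Defensive.

Import GRing.Theory.
Local Open Scope ring_scope.

(* A graph on the vertex type T is given by its adjacency relation e, which is
   symmetric and irreflexive for simple graphs. *)
Section Distance.
Variables (T : finType) (e : rel T).

Definition has_path_of_length (x y : T) (k : nat) : bool :=
  [exists p : k.-tuple T, [&& path e x p, last x p == y & uniq (x :: p)]].

(* The search stops at #|T|, which is out of reach for the length of a path
   without repeated vertices; it is the junk value of gdist when there is no
   path from x to y. *)
Definition gdist (x y : T) : nat :=
  find (has_path_of_length x y) (iota 0 #|T|).

Definition ecc (x : T) : nat := \max_(y : T) gdist x y.

End Distance.

Definition ecc_mx (R : pzRingType) (m : nat) (e : rel 'I_m) : 'M[R]_m :=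
  \matrix_(i, j)
    if gdist e i j == minn (ecc e i) (ecc e j) then (gdist e i j)%:R else 0.

Definition cycle_graph (m : nat) : rel 'I_m :=
  fun i j => (j == ordS i) || (i == ordS j).

(* The n vertices are indexed by 'I_(1 + n.-1), which is 'I_n for n > 0, so that
   matrices come with their decomposition into blocks of sizes 1 and n - 1.
   The hub is the left summand. *)
Definition wheel_graph (n : nat) : rel 'I_(1 + n.-1) :=
  fun u v =>
    match split u, split v with
    | inl _, inl _ => false
    | inr i, inr j => cycle_graph i j
    | _, _ => true
    end.

Lemma wheel_graph_sym (n : nat) : symmetric (@wheel_graph n).
Proof.
move=> u v; rewrite /wheel_graph.
by case: (split u) => i; case: (split v) => j //; rewrite /cycle_graph orbC.
Qed.

Lemma wheel_graph_irr (n : nat) : (4 <= n)%N -> irreflexive (@wheel_graph n).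
Proof.
case: n => [|[|[|n]]] // _ u; rewrite /wheel_graph.
case: (split u) => i //; rewrite /cycle_graph orbb; apply/eqP => /(congr1 val) /=.
have := ltn_ord i; rewrite leq_eqVlt => /orP[/eqP[->]|lt_i].
  by rewrite modnn.
by rewrite modn_small // => /n_Sn.
Qed.

Lemma wheel_graph_connected (n : nat) (u v : 'I_(1 + n.-1)) :
  connect (@wheel_graph n) u v.
Proof.
have hub w : connect (@wheel_graph n) w (lshift n.-1 ord0).
  case: (split_ordP w) => i ->; first by rewrite (ord1 i) connect0.
  by apply: connect1; rewrite /wheel_graph -/(unsplit (inr i))
    -/(unsplit (inl (ord0 : 'I_1))) !unsplitK.
apply: connect_trans (hub u) _.
by rewrite (sym_connect_sym (@wheel_graph_sym n)) hub.
Qed.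

(* Row i is the first row c shifted cyclically to the right i times. *)
Definition circulant (R : Type) (m : nat) (c : 'rV[R]_m) : 'M[R]_m :=
  \matrix_(i, j) c 0 (iter i (@ord_pred m) j).

Section InverseFormula.
Variables (R : realFieldType) (n : nat).

Definition xbar : 'cV[R]_n.-1 :=
  \col_j ((2 - n%:R) :: flatten (nseq ((n - 2) %/ 3) [:: 1; -2; 1]))`_j.

Definition ybar : 'cV[R]_n.-1 :=
  \col_j ((- n%:R) :: flatten (nseq ((n - 3) %/ 3) [:: 2; -1; -1]) ++ [:: 2])`_j.

(* xbar has length 1 + 3k and ybar has length 2 + 3k, so the two cases below
   are meaningful for n = 2 and n = 0 modulo 3 only. *)
Definition Mblock : 'M[R]_n.-1 :=
  if (n %% 3 == 2)%N then 3^-1 *: circulant xbar^T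
  else 3^-1 *: circulant ybar^T.

Definition Ltilde : 'M[R]_(1 + n.-1) :=
  ((n%:R - 1) / 3)%:M
  - 3^-1 *: block_mx 0 (const_mx 1) (const_mx 1) 0
  + block_mx 0 0 0 Mblock.

Definition wvec : 'cV[R]_(1 + n.-1) :=
  6^-1 *: col_mx (7 - n%:R)%:M (const_mx 1).

End InverseFormula.

(* Main.v *)
Require Import Defs.
From mathcomp Require Import all_boot all_order all_algebra.
From mathcomp Require Import zify ring.

(** Put [m = n - 1], let [J] be the all-ones matrix of order [m] and
    [C = Circ(1, 1, 0, ..., 0, 1)].  Distances in the wheel are at most 2, so
    [E = [[0, e'], [e, 2 (J - C)]]].  The vector [z = m e_1 + xbar] (or
    [m e_1 + ybar]) is 3-periodic up to the wrap-around, and its sums over three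
    cyclically consecutive entries are all 0 except the one centred at the first
    entry, which is 3; that is, [C Circ(z') = 3 I].  As [J C = 3 J], it
    follows that [J Circ(z') = J], and [E X = I] is then a block computation. *)

Set Implicit Arguments.
Unset Strict Implicit.
Unset Printing Implicit Defensive.

Import GRing.Theory Num.Theory.
Local Open Scope ring_scope.

(** * Distances 0, 1 and 2 in an arbitrary graph *)

Section SmallDistances.
Variables (T : finType) (e : rel T).

Lemma has_path_of_length0 (x y : T) : has_path_of_length e x y 0 = (x == y).
Proof.
apply/existsP/idP => [[p]|/eqP <-]; last by exists [tuple]; rewrite /= eqxx.
by rewrite tuple0 /= andbT.
Qed.

Lemma has_path_of_length1 (x y : T) :
  x != y -> has_path_of_length e x y 1 = e x y.
Proof.
move=> nxy; apply/existsP/idP => [[p]|exy].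
  by case/tupleP: p => a p; rewrite tuple0 /= andbT => /and3P[exa /eqP <-].
by exists [tuple y]; rewrite /= exy eqxx inE nxy.
Qed.

Lemma gdistxx (x : T) : gdist e x x = 0%N.
Proof.
(* [gdist] only searches lengths below [#|T|]. Here and in the next two lemmas, counting the
   vertices of the path shows that its length is within that range. *)
have := max_card (pred1 x); rewrite card1 /gdist.
by case: #|T| => // k _; rewrite /= has_path_of_length0 eqxx.
Qed.

Lemma gdist_edge (x y : T) : x != y -> e x y -> gdist e x y = 1%N.
Proof.
move=> nxy exy; have := max_card (pred2 x y); rewrite card2 nxy /gdist.
case: #|T| => [|[|k]] //= _.
by rewrite has_path_of_length0 has_path_of_length1 // (negPf nxy) exy.
Qed.

Lemma gdist_two_steps (x y z : T) :
  uniq [:: x; z; y] -> ~~ e x y -> e x z -> e z y -> gdist e x y = 2%N.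
Proof.
move=> u nexy exz ezy; have := max_card (mem [:: x; z; y]).
rewrite (card_uniqP u) /gdist; case: #|T| => [|[|[|k]]] //= _.
have nxy : x != y by move: u; rewrite /= !inE negb_or => /and3P[/andP[]].
rewrite has_path_of_length0 has_path_of_length1 // (negPf nxy) (negPf nexy).
suff -> : has_path_of_length e x y 2 by [].
by apply/existsP; exists [tuple z; y]; rewrite u /= exz ezy eqxx.
Qed.

End SmallDistances.

(** * Iterated cyclic shifts of indices *)

Section CyclicOrdinals.
Variable m : nat.
Implicit Types i j : 'I_m.

Lemma val_iter_ordS k i : val (iter k (@ordS m) i) = ((i + k) %% m)%N.
Proof.
elim: k => [|k IHk] /=; first by rewrite addn0 modn_small.
by rewrite IHk -addn1 modnDml -addnA addn1.
Qed.

Lemma iter_ordS_neq k i : (0 < k < m)%N -> iter k (@ordS m) i != i.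
Proof.
case/andP=> k_gt0 ltkm; apply/eqP => /(congr1 val); rewrite val_iter_ordS => ik.
have /eqP : i + k = i + 0 %[mod m] by rewrite addn0 ik modn_small.
by rewrite eqn_modDl modn_small // mod0n eqn0Ngt k_gt0.
Qed.

Lemma val_iter_ord_pred k i :
  (k <= i)%N -> val (iter k (@ord_pred m) i) = (i - k)%N.
Proof.
elim: k => [|k IHk] /= ltki; first by rewrite subn0.
rewrite IHk; last exact: ltnW.
have lt_im := ltn_ord i.
have -> : ((i - k + m).-1 = (i - k.+1) + m)%N by lia.
by rewrite modnDr modn_small //; lia.
Qed.

(** Iterates of [ord_pred] are injective, and [i] steps down from [i] lead to 0. In a circulant, the
    first entry of the first row therefore fills exactly the diagonal. *)
Lemma iter_ord_pred_eq0 i j : (val (iter i (@ord_pred m) j) == 0%N) = (i == j).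
Proof.
have i0 : val (iter i (@ord_pred m) i) = 0%N by rewrite val_iter_ord_pred // subnn.
apply/eqP/eqP => [j0|<- //].
have inj_pred : injective (iter i (@ord_pred m)).
  by elim: (val i) => [|k IHk] x y //= /(can_inj (@ord_predK m))/IHk.
by apply: inj_pred; apply: val_inj; rewrite i0 j0.
Qed.

Lemma iter_ord_pred_id i : iter m (@ord_pred m) i = i.
Proof.
have canS k : cancel (iter k (@ordS m)) (iter k (@ord_pred m)).
  by elim: k => [|k IHk] x //=; rewrite -iterS iterSr ordSK IHk.
rewrite -{2}(canS m i); congr iter; apply: val_inj.
by rewrite val_iter_ordS modnDr modn_small.
Qed.

(** This turns a move to the next row of a circulant into a shift of the column index. At the last
    row [ordS i] wraps to 0, and the [m]-fold iterate is the identity. *)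
Lemma iter_ord_pred_ordS i j :
  iter (ordS i) (@ord_pred m) j = ord_pred (iter i (@ord_pred m) j).
Proof.
rewrite -iterS [val (ordS i)]/=; have := ltn_ord i.
rewrite leq_eqVlt => /orP[/eqP->|lt_im]; last by rewrite modn_small.
by rewrite modnn iter_ord_pred_id.
Qed.

Lemma iter_ord_pred_pred i j :
  iter (ord_pred i) (@ord_pred m) j = ordS (iter i (@ord_pred m) j).
Proof. by rewrite -{2}[i]ord_predK iter_ord_pred_ordS ord_predK. Qed.

End CyclicOrdinals.

(** * The matrix [C], written [cycle_band], and its products *)

Definition cycle_band (R : pzRingType) (m : nat) : 'M[R]_m :=
  \matrix_(i, j) ((j == i)%:R + (j == ordS i)%:R + (j == ord_pred i)%:R).

Section CycleBand.
Variables (R : comNzRingType) (m : nat).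

Lemma mulmx_cycle_band p (A : 'M[R]_(m, p)) i j :
  (cycle_band R m *m A) i j = A i j + A (ordS i) j + A (ord_pred i) j.
Proof.
rewrite mxE; under eq_bigr do rewrite mxE !mulrDl !mulr_natl !mulrb.
by rewrite !big_split -!big_mkcond !big_pred1_eq.
Qed.

Lemma trmx_cycle_band : (cycle_band R m)^T = cycle_band R m.
Proof.
apply/matrixP=> i j; rewrite !mxE addrAC [i == j]eq_sym.
congr (_ + _%:R + _%:R); congr nat_of_bool.
  by apply/eqP/eqP => ->; rewrite ?ordSK ?ord_predK.
by apply/eqP/eqP => ->; rewrite ?ordSK ?ord_predK.
Qed.

Lemma ones_mul_cycle_band :
  (const_mx 1 : 'rV[R]_m) *m cycle_band R m = const_mx 3.
Proof.
rewrite -[LHS]trmxK trmx_mul trmx_cycle_band.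
apply/matrixP=> i j; rewrite mxE mulmx_cycle_band !mxE.
by ring.
Qed.

(** Each entry of the product is a sum of three cyclically consecutive values of [z], centred at
    some [k]. The last hypothesis settles [k = 0]; for [k = m - 1] the value [z 0] is replaced by
    [z m], so that the vanishing sums apply. *)
Lemma cycle_band_mul_circulant (z : nat -> R) :
    (1 < m)%N -> (forall j, z j + z j.+1 + z j.+2 = 0) -> z m = z 0%N ->
    z m.-1 + z 0%N + z 1%N = 3 ->
  cycle_band R m *m circulant (\row_(j < m) z j) = 3%:M.
Proof.
move=> m_gt1 z3 zm z0; apply/matrixP=> i j.
rewrite mulmx_cycle_band !mxE iter_ord_pred_ordS iter_ord_pred_pred.
rewrite -iter_ord_pred_eq0; move: (iter _ _ _) => k /=.
have ltkm := ltn_ord k.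
case: eqP => [k0|/eqP k_neq0].
  rewrite k0 add0n !modn_small //; last by lia.
  by rewrite -z0 [RHS]mulr1n; ring.
have -> : ((k + m).-1 %% m = k.-1)%N.
  have -> : ((k + m).-1 = k.-1 + m)%N by lia.
  by rewrite modnDr modn_small //; lia.
have -> : z (k.+1 %% m)%N = z k.+1.
  have := ltkm; rewrite leq_eqVlt => /orP[/eqP->|lt].
    by rewrite modnn zm.
  by rewrite modn_small.
have := z3 k.-1; rewrite prednK ?lt0n // => zk.
by rewrite [RHS]mulr0n -zk; ring.
Qed.

End CycleBand.

(** * The eccentricity matrix of the wheel *)

Section WheelEccentricity.
Variable m : nat.
Hypothesis m_gt3 : (3 < m)%N.
Implicit Types i j : 'I_m.

Local Notation W := (@wheel_graph m.+1).
Local Notation hub := (lshift m (ord0 : 'I_1)).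
Local Notation rim i := (rshift 1 (i : 'I_m)).

Lemma wheel_graph_hubl i : W hub (rim i).
Proof.
by rewrite /wheel_graph -/(unsplit (inl ord0)) -/(unsplit (inr i)) !unsplitK.
Qed.

Lemma wheel_graph_hubr i : W (rim i) hub.
Proof. by rewrite wheel_graph_sym wheel_graph_hubl. Qed.

Lemma wheel_graph_rim i j : W (rim i) (rim j) = cycle_graph i j.
Proof.
by rewrite /wheel_graph -/(unsplit (inr i)) -/(unsplit (inr j)) !unsplitK.
Qed.

Lemma gdist_hubl i : gdist W hub (rim i) = 1%N.
Proof.
by apply: gdist_edge (wheel_graph_hubl i); rewrite (@eq_lrshift 1 m ord0 i).
Qed.

Lemma gdist_hubr i : gdist W (rim i) hub = 1%N.
Proof.
by apply: gdist_edge (wheel_graph_hubr i); rewrite (@eq_rlshift 1 m i ord0).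
Qed.

Lemma gdist_rim i j :
  gdist W (rim i) (rim j) =
  if i == j then 0%N else if cycle_graph i j then 1%N else 2%N.
Proof.
have [->|nij] := eqVneq i j; first exact: gdistxx.
case: ifP => [cij|/negbT ncij].
  by apply: gdist_edge; rewrite ?wheel_graph_rim // (@eq_rshift 1 m i j).
apply: (@gdist_two_steps _ _ _ _ hub); rewrite ?wheel_graph_rim //.
- rewrite /= !inE (@eq_rlshift 1 m i ord0) (@eq_rshift 1 m i j).
  by rewrite (negPf nij).
- exact: wheel_graph_hubr.
- exact: wheel_graph_hubl.
Qed.

Lemma ecc_hub : ecc W hub = 1%N.
Proof.
apply/eqP; rewrite eqn_leq; apply/andP; split.
  apply/bigmax_leqP => u _; have [i ->|i ->] := split_ordP u.
    by rewrite (ord1 i) gdistxx.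
  by rewrite gdist_hubl.
have m_gt0 : (0 < m)%N by apply: leq_trans m_gt3.
rewrite -[X in (X <= _)%N](gdist_hubl (Ordinal m_gt0)).
exact: (leq_bigmax (F := fun u => gdist W hub u)).
Qed.

Lemma ecc_rim i : ecc W (rim i) = 2%N.
Proof.
apply/eqP; rewrite eqn_leq; apply/andP; split.
  apply/bigmax_leqP => u _; have [j ->|j ->] := split_ordP u.
    by rewrite (ord1 j) gdist_hubr.
  by rewrite gdist_rim; do 2?case: ifP.
(* The vertex two steps further along the rim is neither [i] nor a neighbour of [i], because 1, 2
   and 3 are nonzero modulo [m]; this is where [m > 3] matters. *)
have d2 : gdist W (rim i) (rim (ordS (ordS i))) = 2%N; last first.
  rewrite -[X in (X <= _)%N]d2.
  exact: (leq_bigmax (F := fun u => gdist W (rim i) u)).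
rewrite gdist_rim /cycle_graph (inj_eq (can_inj (@ordSK m))) eq_sym.
have n1 := @iter_ordS_neq m 1 i; have n2 := @iter_ordS_neq m 2 i.
have n3 := @iter_ordS_neq m 3 i; rewrite /= in n1 n2 n3.
rewrite (negPf (n2 _)) ?(negPf (n1 _)) 1?[i == _]eq_sym ?(negPf (n3 _)) //.
all: by apply: leq_trans m_gt3.
Qed.

(** Hub-rim distances equal the hub's eccentricity 1 and survive. Between rim vertices only distance
    2 survives, so the nonzero entries there are those where [C] vanishes. *)
Lemma ecc_mx_wheel (R : comNzRingType) :
  ecc_mx R W =
  block_mx 0 (const_mx 1) (const_mx 1) (2 *: (const_mx 1 - cycle_band R m)).
Proof.
apply/matrixP => u v; rewrite mxE.
have [i ->|i ->] := split_ordP u; have [j ->|j ->] := split_ordP v.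
- by rewrite (ord1 i) (ord1 j) gdistxx block_mxEul mxE if_same.
- by rewrite (ord1 i) gdist_hubl ecc_hub ecc_rim block_mxEur mxE.
- by rewrite (ord1 j) gdist_hubr ecc_hub ecc_rim block_mxEdl mxE.
rewrite gdist_rim !ecc_rim block_mxEdr !mxE /cycle_graph.
rewrite [i == ordS j]eq_sym (can2_eq (@ordSK m) (@ord_predK m)) [i == j]eq_sym.
have n1 := @iter_ordS_neq m 1 _; have n2 := @iter_ordS_neq m 2 _.
rewrite /= in n1 n2.
(* As [i], [ordS i] and [ord_pred i] are distinct, at most one of the three terms of [cycle_band] is
   1. *)
have [->|_] := eqVneq j i.
  rewrite -(can2_eq (@ordSK m) (@ord_predK m)) [i == _]eq_sym.
  rewrite (negPf (n1 i _)) /=; first by ring.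
  by apply: leq_trans m_gt3.
have [->|_] := eqVneq j (ordS i).
  rewrite -(can2_eq (@ordSK m) (@ord_predK m)) (negPf (n2 i _)) /=.
    by ring.
  by apply: leq_trans m_gt3.
by case: (j == ord_pred i) => /=; ring.
Qed.

End WheelEccentricity.

(** * The block [M] as a shifted periodic circulant *)

Section LtildeBlocks.
Variable R : realFieldType.

Lemma nth_flatten_nseq3 (a b c : R) (t : seq R) (q j : nat) :
  (flatten (nseq q [:: a; b; c]) ++ t)`_j =
  if (j < 3 * q)%N then [:: a; b; c]`_(j %% 3) else t`_(j - 3 * q).
Proof.
elim: q j => [|q IHq] [|[|[|j]]] //=; rewrite ?muln0 ?subn0 ?mulnS //.
by rewrite IHq -[in RHS](addn3 j) modnDr addnC ltn_add2l subnDl.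
Qed.

Definition periodic3 (a b c : R) (j : nat) : R := [:: a; b; c]`_(j %% 3).

Lemma periodic3S (a b c : R) j : periodic3 a b c j.+1 = periodic3 b c a j.
Proof.
rewrite /periodic3 -addn1 -modnDml.
by case: (j %% 3)%N (ltn_pmod j (isT : 0 < 3)%N) => [|[|[|k]]].
Qed.

Lemma periodic3_sum (a b c : R) j :
  periodic3 a b c j + periodic3 a b c j.+1 + periodic3 a b c j.+2 = a + b + c.
Proof.
rewrite !periodic3S /periodic3.
by case: (j %% 3)%N (ltn_pmod j (isT : 0 < 3)%N) => [|[|[|k]]] //= _; ring.
Qed.

(** Only the first entry of [xbar] or [ybar] breaks the periodic pattern. Adding [m] to it repairs
    the pattern, and on circulants this adds [m] times the identity. *)
Lemma Mblock_cycle_band m :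
  (6 < m)%N -> (m.+1 %% 3 != 1)%N ->
  exists Z : 'M[R]_m, cycle_band R m *m Z = 3%:M /\
    Mblock R m.+1 = 3^-1 *: (Z - m%:R%:M).
Proof.
move=> m_gt6 m_mod.
have circ_shift (c z : 'rV[R]_m) :
    (forall k : 'I_m, c 0 k = z 0 k - m%:R *+ (val k == 0%N)) ->
  circulant c = circulant z - m%:R%:M.
  by move=> cz; apply/matrixP=> i j; rewrite !mxE cz iter_ord_pred_eq0.
have m_gt1 : (1 < m)%N by apply: leq_trans m_gt6.
rewrite /Mblock; case: ifPn => [/eqP m2|m_n2].
  have [q mq] : exists q, m = (3 * q).+1 by exists (m %/ 3)%N; lia.
  (* The first entry is [2 - n + m = 1]. The row ends with 1, so the sum around the first entry is 1
     + 1 + 1. *)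
  exists (circulant (\row_(j < m) periodic3 1 1 (-2) j)); split.
    apply: cycle_band_mul_circulant m_gt1 _ _ _.
    - by move=> j; rewrite periodic3_sum; ring.
    - by rewrite mq periodic3S /periodic3 modnMr.
    - by rewrite mq /periodic3 modnMr /=; ring.
  congr (_ *: _); apply: circ_shift => k; rewrite !mxE.
  case: k => -[|j] ltjm /=; first by rewrite /periodic3 /=; ring.
  rewrite -[flatten _]cats0 nth_flatten_nseq3 periodic3S subr0.
  by rewrite ifT //; lia.
have [q mq] : exists q, m = (3 * q).+2 by exists (m %/ 3)%N; lia.
(* The first entry is [- n + m = -1]. The row ends with the extra 2 of [ybar], so the sum around the
   first entry is 2 - 1 + 2. *)
exists (circulant (\row_(j < m) periodic3 (-1) 2 (-1) j)); split.
  apply: cycle_band_mul_circulant m_gt1 _ _ _.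
  - by move=> j; rewrite periodic3_sum; ring.
  - by rewrite mq !periodic3S /periodic3 modnMr.
  - by rewrite mq !periodic3S /periodic3 modnMr /=; ring.
congr (_ *: _); apply: circ_shift => k; rewrite !mxE.
case: k => -[|j] ltjm /=; first by rewrite /periodic3 /=; ring.
have -> : ((m.+1 - 3) %/ 3 = q)%N by lia.
rewrite nth_flatten_nseq3 periodic3S subr0.
case: ltnP => // leqj; have -> : j = (3 * q)%N by lia.
by rewrite subnn /periodic3 modnMr.
Qed.

End LtildeBlocks.

Theorem theorem5p11 (R : realFieldType) (n : nat)
    (hn : (8 <= n)%N) (hmod : (n %% 3 != 1)%N) :
  let E : 'M[R]_(1 + n.-1) := ecc_mx R (@wheel_graph n) in
  let w : 'cV[R]_(1 + n.-1) := wvec R n in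
  E \in unitmx /\
  invmx E = - 2^-1 *: Ltilde R n + (6 / (n%:R - 1)) *: (w *m w^T).
Proof.
move=> E w; set X := (X in invmx _ = X).
suff EX : E *m X = 1%:M.
  have [Eu _] := mulmx1_unit EX; split=> //.
  by rewrite -[RHS](mulKmx Eu) EX mulmx1.
move: @E @w @X hn hmod; case: n => // m E w X m_gt6 m_mod.
have m_neq0 : m%:R != 0 :> R by rewrite pnatr_eq0; lia.
have [Z [CZ defM]] := Mblock_cycle_band R m_gt6 m_mod.
pose e : 'rV[R]_m := const_mx 1.
have JE : const_mx 1 = e^T *m e :> 'M_m.
  by apply/matrixP=> i j; rewrite !mxE big_ord1 !mxE mulr1.
have ee : e *m e^T = m%:R%:M.
  apply/matrixP=> i j; rewrite !mxE (eq_bigr (fun=> 1)) => [|k _].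
    by rewrite sumr_const card_ord !ord1 eqxx.
  by rewrite !mxE mulr1.
have eC : e *m cycle_band R m = 3 *: e.
  by rewrite ones_mul_cycle_band; apply/matrixP=> i j; rewrite !mxE mulr1.
have Ce : cycle_band R m *m e^T = 3 *: e^T.
  by rewrite -[LHS]trmxK trmx_mul trmxK trmx_cycle_band eC linearZ.
(* Evaluate [e C Z] in two ways and cancel 3. *)
have eZ : e *m Z = e.
  apply: (scalerI (a := 3 : R)); first by rewrite pnatr_eq0.
  by rewrite scalemxAl -eC -mulmxA CZ mul_mx_scalar.
(* Since [7 - n = 6 - m], the corner is [- m / 6 + (6 - m)^2 / (6 m)] and the border is
   [1 / 6 + (6 - m) / (6 m)]. In the last block the scalar part of [Ltilde] cancels the [- m I] in
   [Mblock]. *)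
have -> : X = block_mx ((6 - 2 * m%:R) / m%:R)%:M (m%:R^-1 *: e)
    (m%:R^-1 *: e^T) ((6 * m%:R)^-1 *: (e^T *m e) - 6^-1 *: Z).
  rewrite /X /Ltilde /w /wvec defM -/e.
  rewrite (_ : const_mx 1 = e^T :> 'cV_m); last by rewrite trmx_const.
  have -> : m.+1%:R - 1 = m%:R :> R by ring.
  rewrite [(_ *: _)^T]linearZ /= tr_col_mx -scalemxAl -scalemxAr.
  rewrite mul_col_row trmxK.
  rewrite tr_scalar_mx -!scalar_mxM mul_scalar_mx mul_mx_scalar.
  rewrite scalar_mx_block !(scale_block_mx, opp_block_mx, add_block_mx).
  congr block_mx; apply/matrixP=> i j; rewrite ?JE !mxE ?ord1 /=.
  - by rewrite !mulr1n; field.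
  - by field.
  - by field.
  move: (\sum_k _) (Z i j) => s t.
  by case: (i == j); rewrite ?mulr1n ?mulr0n; field.
rewrite /E ecc_mx_wheel; last by lia.
rewrite JE (_ : const_mx 1 = e^T :> 'cV_m); last by rewrite trmx_const.
rewrite -/e mulmx_block [1%:M in RHS]scalar_mx_block !mul0mx !add0r.
(* With [J] factored as [e^T *m e], the relations [ee], [eZ], [Ce] and [CZ] reduce every block of
   [E X] to a combination of [e], [e^T], [J] and scalar matrices, leaving identities between
   coefficients. *)
rewrite !mulmxBr -!scalemxAr -!scalemxAl !mulmxBl !mulmxA.
rewrite -!(mulmxA e^T) ee eZ Ce CZ !mul_scalar_mx !mul_mx_scalar.
rewrite -scalemxAr -!scalemxAl; move: (e^T *m e) => J.
by congr block_mx; apply/matrixP=> i j; rewrite !mxE ?ord1 /=; field.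
Qed.
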